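(* Let $n\ge 15$ and let $m$ be the integer such that $k_{m+3}\le n+1<k_{m+4}$. Put $\alpha_m=k_{m+3}+t_{m-4}$ and $\beta_m=k_{m+3}+t_{m-4}+t_{m-3}$. Then $m\ge4$ and $$\sum_{i=k_{m+3}-1}^{n}b(i)=\begin{cases}\displaystyle\sum_{i=k_{m}-1}^{n-t_{m-1}}b(i)+n-k_{m+3}+2, & n+1<\alpha_m,\\[2ex] \displaystyle\sum_{i=k_{m+1}-1}^{n-t_{m-1}}b(i)+D(m-3)+n-k_{m+3}+2, & \alpha_m\le n+1<\beta_m,\\[2ex] \displaystyle\sum_{i=k_{m+2}-1}^{n-t_{m-1}}b(i)+D(m-3)+D(m-2)+n-k_{m+3}+2, & \beta_m\le n+1,\end{cases}$$ where $D(j)=\frac{j}{22}(3t_{j}+7t_{j-1}+2t_{j-2})+\frac{1}{22}(3t_{j}-3t_{j-1}+4t_{j-2})$ for $j\ge1$.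
   Context: The Tribonacci sequence $\mathbb{T}$ is the infinite word over $\{a,b,c\}$ that is the fixed point beginning with $a$ of the morphism $\tau(a)=ab$, $\tau(b)=ac$, $\tau(c)=a$; positions are numbered from $1$, and $\mathbb{T}[1,n]$ is its prefix of length $n$. The numbers $t_m$ are given by $t_{-2}=0$, $t_{-1}=t_0=1$, $t_m=t_{m-1}+t_{m-2}+t_{m-3}$ for $m\ge 1$. The kernel numbers are $k_0=0$, $k_1=k_2=1$, $k_m=k_{m-1}+k_{m-2}+k_{m-3}-1$ for $m\ge 3$. $\mathcal{P}_T$ is the set of nonempty palindromes occurring as factors (finite contiguous subwords) of $\mathbb{T}$. For a factor $\omega$ and $p\ge1$, $\omega_p$ denotes the $p$-th occurrence of $\omega$ in $\mathbb{T}$. For $n\ge1$, $b(n)$ is the number of pairs $(\omega,p)$ with $\omega\in\mathcal{P}_T$, $p\ge1$, such that $\omega_p$ ends exactly at position $n$ (i.e. is a suffix of $\mathbb{T}[1,n]$). *)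

(* Defs.v *)
From HB Require Import structures.
From mathcomp Require Import all_boot all_order all_algebra.
From mathcomp Require Import finmap.
From mathcomp Require Import boolp classical_sets functions cardinality.
From mathcomp Require Import zify.

Set Implicit Arguments.
Unset Strict Implicit.
Unset Printing Implicit Defensive.

Import GRing.Theory Num.Theory.

Local Open Scope nat_scope.

Inductive letter := La | Lb | Lc.

Definition nat_of_letter (x : letter) : nat :=
  match x with La => 0 | Lb => 1 | Lc => 2 end.

Definition letter_of_nat (i : nat) : option letter :=
  match i with 0 => Some La | 1 => Some Lb | 2 => Some Lc | _ => None end.

Lemma nat_of_letterK : pcancel nat_of_letter letter_of_nat.
Proof. by case. Qed.

HB.instance Definition _ := Countable.copy letter (pcan_type nat_of_letterK).

Definition tau1 (x : letter) : seq letter :=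
  match x with La => [:: La; Lb] | Lb => [:: La; Lc] | Lc => [:: La] end.

Definition tau (w : seq letter) : seq letter := flatten (map tau1 w).

(* Infinite words are functions [nat -> letter] whose positions start at 1;   *)
(* the value at 0 is never used.  [subword T i l] is T[i, i + l - 1].         *)
Definition subword (T : nat -> letter) (i l : nat) : seq letter :=
  [seq T j | j <- iota i l].

(* T = tau(T): since tau never erases, this says that the image of every      *)
(* finite prefix of T is again a prefix of T.                                 *)
Definition tau_fixed (T : nat -> letter) : Prop :=
  forall n, tau (subword T 1 n) = subword T 1 (size (tau (subword T 1 n))).

(* tau^i(a) is a prefix of T of length at least i; that T is the unique       *)
(* fixed point beginning with a is [tribonacciP] and [tribonacci_unique].     *)
Definition tribonacci (i : nat) : letter := nth La (iter i tau [:: La]) i.-1.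

(* [tnum_shift i] is t_(i - 2). *)
Fixpoint tnum_shift (i : nat) : nat :=
  match i with
  | 0 => 0
  | 1 | 2 => 1
  | (((i0.+1) as i1).+1 as i2).+1 =>
      tnum_shift i2 + tnum_shift i1 + tnum_shift i0
  end.

(* t_m for m >= -2, extended by 0. *)
Definition tnum (m : int) : nat :=
  match (m + 2)%R with Posz i => tnum_shift i | Negz _ => 0 end.

(* The truncated subtraction is harmless: the sum is always positive. *)
Fixpoint knum_nat (i : nat) : nat :=
  match i with
  | 0 => 0
  | 1 | 2 => 1
  | (((i0.+1) as i1).+1 as i2).+1 =>
      knum_nat i2 + knum_nat i1 + knum_nat i0 - 1
  end.

(* k_m for m >= 0, extended by 0. *)
Definition knum (m : int) : nat :=
  match m with Posz i => knum_nat i | Negz _ => 0 end.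

Definition occurs_at (w : seq letter) (i : nat) : bool :=
  (0 < i) && (subword tribonacci i (size w) == w).

Definition is_factor (w : seq letter) : Prop := exists i, occurs_at w i.

Definition palT : set (seq letter) :=
  [set w | [/\ w <> [::], rev w = w & is_factor w]].

(* The p-th occurrence of w begins at position i. *)
Definition nth_occ (w : seq letter) (p i : nat) : Prop :=
  occurs_at w i /\ count (occurs_at w) (iota 1 i) = p.

Definition nth_occ_ends (w : seq letter) (p n : nat) : Prop :=
  exists2 i, nth_occ w p i & i + size w = n.+1.

Definition pal_occ (n : nat) : set (seq letter * nat) :=
  [set wp | [/\ palT wp.1, 1 <= wp.2 & nth_occ_ends wp.1 wp.2 n]].

(* [fset_set] is meaningful on finite sets only, see [finite_pal_occ]. *)
Definition bnum (n : nat) : nat := #|` fset_set (pal_occ n)|.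

Definition Dnum (j : int) : rat :=
  (j%:~R / 22 * (3 * (tnum j)%:R + 7 * (tnum (j - 1))%:R
                 + 2 * (tnum (j - 2))%:R)
   + 1 / 22 * (3 * (tnum j)%:R - 3 * (tnum (j - 1))%:R
               + 4 * (tnum (j - 2))%:R))%R.

Lemma tau_cat u v : tau (u ++ v) = tau u ++ tau v.
Proof. by rewrite /tau map_cat flatten_cat. Qed.

Lemma size_tau_geq u : size u <= size (tau u).
Proof.
by elim: u => //= x u IH; rewrite /tau /= size_cat; case: x => /=; move: IH;
   rewrite /tau; lia.
Qed.

Lemma tau_prefix u v : prefix u v -> prefix (tau u) (tau v).
Proof. by move=> /prefixP[w ->]; rewrite tau_cat prefix_prefix. Qed.

Lemma iter_tau_prefixS n : prefix (iter n tau [:: La]) (iter n.+1 tau [:: La]).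
Proof. by elim: n => // n IH; rewrite !iterS tau_prefix. Qed.

Lemma iter_tau_prefix m n : m <= n ->
  prefix (iter m tau [:: La]) (iter n tau [:: La]).
Proof.
move=> /subnKC <-; elim: (n - m) => [|d IH]; first by rewrite addn0 prefix_refl.
by rewrite addnS; apply: prefix_trans IH (iter_tau_prefixS _).
Qed.

Lemma size_iter_tau n : n < size (iter n tau [:: La]).
Proof.
suff: n < size (iter n tau [:: La]) /\ exists u, iter n tau [:: La] = La :: u.
  by case.
elim: n => [|n [IH [u eu]]]; first by split=> //; exists [::].
rewrite iterS; split; last by exists (Lb :: tau u); rewrite eu.
by move: IH; rewrite eu /tau /=; have := size_tau_geq u; rewrite /tau; lia.
Qed.

Lemma nth_prefix (x0 : letter) u v i :
  prefix u v -> i < size u -> nth x0 v i = nth x0 u i.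
Proof. by move=> /prefixP[w ->] iu; rewrite nth_cat iu. Qed.

Lemma tribonacciE n i : i < size (iter n tau [:: La]) ->
  tribonacci i.+1 = nth La (iter n tau [:: La]) i.
Proof.
move=> lti; rewrite /tribonacci /=.
have si := size_iter_tau i.+1.
case: (leqP i.+1 n) => le.
  by rewrite -(nth_prefix _ (iter_tau_prefix le)) //; apply: ltnW.
by rewrite -(nth_prefix _ (iter_tau_prefix (ltnW le))).
Qed.

Lemma size_subword T i l : size (subword T i l) = l.
Proof. by rewrite size_map size_iota. Qed.

Lemma subword_prefixE T u :
  (forall i, i < size u -> T i.+1 = nth La u i) -> subword T 1 (size u) = u.
Proof.
move=> H; apply: (@eq_from_nth _ La); rewrite size_subword // => i iu.
by rewrite (nth_map 0) ?size_iota // nth_iota // add1n H.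
Qed.

Lemma subword_prefix T m n : m <= n -> prefix (subword T 1 m) (subword T 1 n).
Proof.
by move=> /subnKC <-; rewrite /subword iotaD map_cat prefix_prefix.
Qed.

Lemma prefix_subword T u n :
  prefix u (subword T 1 n) -> u = subword T 1 (size u).
Proof.
move=> pu; have := pu; rewrite prefixE => /eqP <-.
have le : size u <= n by rewrite -(size_subword T 1 n) size_prefix.
have /prefixP[w ->] := subword_prefix T le.
by rewrite take_size_cat ?size_subword // size_subword.
Qed.

Lemma subword_trib n :
  subword tribonacci 1 (size (iter n tau [:: La])) = iter n tau [:: La].
Proof. by apply: subword_prefixE => i; apply: tribonacciE. Qed.

Theorem tribonacciP : tau_fixed tribonacci /\ tribonacci 1 = La.
Proof.
split=> // n; apply: (@prefix_subword _ _ (size (iter n.+1 tau [:: La]))).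
rewrite subword_trib iterS; apply: tau_prefix; rewrite -subword_trib.
by apply: subword_prefix; apply: ltnW (size_iter_tau n).
Qed.

Theorem tribonacci_unique T :
  tau_fixed T -> T 1 = La -> forall i, 0 < i -> T i = tribonacci i.
Proof.
move=> fT T1.
have H n : subword T 1 (size (iter n tau [:: La])) = iter n tau [:: La].
  elim: n => [|n IH]; first by rewrite /subword /= T1.
  by have := fT (size (iter n tau [:: La])); rewrite IH -iterS.
case=> // i _; have si := ltnW (size_iter_tau i.+1).
rewrite /tribonacci /= -iterS -[in RHS](H i.+1).
by rewrite (nth_map 0) ?size_iota // nth_iota // add1n.
Qed.

Lemma finite_pal_occ n : finite_set (pal_occ n).
Proof.
pose s := [seq (subword tribonacci i (n.+1 - i),
                count (occurs_at (subword tribonacci i (n.+1 - i))) (iota 1 i))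
          | i <- iota 0 n.+2].
apply: (@sub_finite_set _ _ [set` s]); last exact: finite_seq.
move=> [w p] /= [_ _ [i [/= /andP[_ /eqP ew] <-] sw]].
have -> : (w, count (occurs_at w) (iota 1 i)) =
  (subword tribonacci i (n.+1 - i),
   count (occurs_at (subword tribonacci i (n.+1 - i))) (iota 1 i)).
  by rewrite -sw addKn ew.
by apply: (map_f (fun i => (_, _))); rewrite mem_iota -sw; lia.
Qed.

Lemma knum_natS i : knum_nat i.+3 =
  knum_nat i.+2 + knum_nat i.+1 + knum_nat i - 1.
Proof. by []. Qed.

Lemma knum_nat_leS i : knum_nat i <= knum_nat i.+1.
Proof.
suff: [/\ knum_nat i <= knum_nat i.+1, knum_nat i.+1 <= knum_nat i.+2 
        & 0 < knum_nat i.+1] by case.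
elim: i => // i [h1 h2 h3]; split=> //; rewrite ?knum_natS; last exact: leq_trans h2.
by move: h1 h2 h3; lia.
Qed.

Lemma knum_nat_le i j : i <= j -> knum_nat i <= knum_nat j.
Proof.
move=> /subnKC <-; elim: (j - i) => [|d IH]; first by rewrite addn0.
by rewrite addnS; apply: leq_trans IH (knum_nat_leS _).
Qed.

Lemma knum_nat_geq i : i <= knum_nat i.+3.
Proof.
suff: [/\ i <= knum_nat i.+3, 0 < knum_nat i.+1, 0 < knum_nat i.+2
        & i < knum_nat i.+4] by case.
elim: i => // i [h1 h2 h3 h4]; split=> //; first exact: leq_trans h3 (knum_nat_leS _).
by rewrite knum_natS; have := knum_nat_leS i.+2; lia.
Qed.

(* The index m is well defined. *)
Theorem knum_window n : 15 <= n ->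
  exists! m : int, knum (m + 3)%R <= n.+1 < knum (m + 4)%R.
Proof.
move=> hn.
have ex : exists i, n.+1 < knum_nat i by exists n.+2.+3; apply: knum_nat_geq.
case: (ex_minnP ex) => j hj minj.
have j5 : 5 <= j.
  by rewrite leqNgt; apply/negP; case: j {minj} hj => [|[|[|[|[|j]]]]] //=; lia.
have hj1 : knum_nat j.-1 <= n.+1.
  by rewrite leqNgt; apply/negP => /minj; lia.
exists (Posz (j - 4)); split.
  have -> : (Posz (j - 4) + 3)%R = Posz j.-1 by lia.
  have -> : (Posz (j - 4) + 4)%R = Posz j by lia.
  by rewrite /knum hj hj1.
move=> m /andP[m3 m4].
case e : (m + 4)%R m4 => [i|//] /= hi.
have le := minj _ hi.
case: (ltngtP j i) => [lt|lt|eq]; [|lia|lia].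
have e3 : (m + 3)%R = Posz i.-1 by lia.
move: m3; rewrite e3 /= => m3.
have : knum_nat j <= knum_nat i.-1 by apply: knum_nat_le; lia.
by lia.
Qed.

(* Main.v *)
(* The central words P_0 = empty, P_(j+1) = tau(P_j) a are palindromic prefixes
   of T of lengths k_(j+4) - 2. The letter x_j following the prefix P_j has
   period 3 in j, so P_(j+4) is a palindrome having x_j P_j x_j (the kernel word)
   in its middle, and desubstituting tau shows that this word does not occur in
   P_(j+3), hence occurs only once in P_(j+4). Let Q = P_(j+4), P = P_(j+3),
   t = |Q| - |P| and |P| < i <= |Q|. A palindromic suffix of T[1,i] of length more
   than i - t covers the kernel word, and reflecting it in its own centre fixes
   that unique occurrence; so there is exactly one such suffix, the one centred at
   the middle of Q. As P is also a suffix of Q, the shorter palindromic suffixes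
   are those of T[1,i-t]. Hence b(i) = b(i - t_(m-1)) + 1 on the m-th window
   k_(m+3) - 1 <= i <= k_(m+4) - 2. Summing over full windows gives a Tribonacci
   recurrence whose solution is D, and summing over a partial window gives the
   three cases. *)
Require Import Defs.
From mathcomp Require Import all_boot all_order all_algebra.
From mathcomp Require Import finmap.
From mathcomp Require Import classical_sets cardinality.
From mathcomp Require Import zify ring.

Set Implicit Arguments.
Unset Strict Implicit.
Unset Printing Implicit Defensive.

Import GRing.Theory Num.Theory.

Local Open Scope nat_scope.

(** * Central words: palindromicity, prefixes, lengths *)

Definition next_letter (x : letter) : letter :=
  match x with La => Lb | Lb => Lc | Lc => La end.

(* [central_letter j] is the letter that follows the prefix [central j] of T. *)
Definition central_letter (j : nat) : letter := iter j next_letter La.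

Definition central (j : nat) : seq letter :=
  iter j (fun w => rcons (tau w) La) [::].

Lemma centralS j : central j.+1 = rcons (tau (central j)) La.
Proof. by []. Qed.

Lemma central_letter3 j : central_letter j.+3 = central_letter j.
Proof. by rewrite /central_letter !iterS; case: (iter _ _ _). Qed.

Lemma tau_cons x w : tau (x :: w) = tau1 x ++ tau w.
Proof. by []. Qed.

Lemma tau_rcons_La w : exists s, rcons (tau w) La = La :: s.
Proof. by case: w => [|[] w]; eexists. Qed.

(** For each letter [x] the word [tau1 x ++ [:: La]] is a palindrome (aba, aca or aa). *)
Lemma rev_rcons_tau w : rev (rcons (tau w) La) = rcons (tau (rev w)) La.
Proof.
elim: w => // x w IH.
rewrite tau_cons rcons_cat rev_cat IH rev_cons -[rcons (rev w) x]cats1 tau_cat.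
by rewrite -!cats1 -!catA; congr (_ ++ _); case: x.
Qed.

Lemma rev_central j : rev (central j) = central j.
Proof. by elim: j => // j IH; rewrite centralS rev_rcons_tau IH. Qed.

(** Applying [tau] turns P_j x_j into tau(P_j), then a, then [next_letter] of x_j; when x_j is c,
    that second letter is the a following its block. *)
Lemma prefix_centralS j :
  prefix (rcons (central j) (central_letter j)) (central j.+1).
Proof.
elim: j => // j /prefixP[u eu].
rewrite [central j.+2]centralS [in X in tau X]eu -!cats1 !tau_cat.
have -> : central_letter j.+1 = next_letter (central_letter j) by [].
rewrite centralS -!cats1 -!catA prefix_catr //=.
have [s es] := tau_rcons_La u.
by case: (central_letter j) => //=; rewrite ?cats1 es /= ?eqxx ?prefix0s.
Qed.

Lemma prefix_central i j : i <= j -> prefix (central i) (central j).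
Proof.
move=> /subnKC <-; elim: (j - i) => [|d IH]; first by rewrite addn0 prefix_refl.
rewrite addnS; apply: prefix_trans IH _; apply: prefix_trans (prefix_centralS _).
exact: prefix_rcons.
Qed.

Lemma count_mem_tau x w :
  count_mem x (tau w) = match x with
    | La => size w | Lb => count_mem La w | Lc => count_mem Lb w end.
Proof.
elim: w => [|y w IH]; first by case: x.
by rewrite tau_cons count_cat IH; case: x IH; case: y.
Qed.

Lemma size_count_letters (w : seq letter) :
  size w = count_mem La w + count_mem Lb w + count_mem Lc w.
Proof. by elim: w => // -[] w /= ->; rewrite /eq_op /=; lia. Qed.

Lemma size_central j : size (central j) + 2 = knum_nat j.+4.
Proof.
(* P_(i+3) has |P_(i+2)| + 1 letters a, |P_(i+1)| + 1 letters b and |P_i| + 1 letters c. *)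
have H i : size (central i.+3) =
    size (central i.+2) + size (central i.+1) + size (central i) + 3.
  rewrite [LHS]size_count_letters !centralS -!cats1 !count_cat !count_mem_tau /=.
  rewrite !count_cat !count_mem_tau !count_cat !count_mem_tau /=.
  rewrite !size_cat /= /eq_op /=; lia.
suff: [/\ size (central j) + 2 = knum_nat j.+4,
  size (central j.+1) + 2 = knum_nat j.+1.+4 &
  size (central j.+2) + 2 = knum_nat j.+2.+4] by case.
elim: j => // j [h0 h1 h2]; split=> //.
by rewrite H (knum_natS j.+4) -h0 -h1 -h2; lia.
Qed.

(** * Desubstitution and the kernel word *)

(* Every block of tau begins with a; hence b ends the block of a, c that of b, and
   an a followed by another a is the block of c. *)
Lemma desubstitute_cons (x : letter) P g s :
  rcons (tau P) La = g ++ next_letter x :: La :: s ->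
  exists G S, P = G ++ x :: S /\ La :: s = rcons (tau S) La.
Proof.
elim: P g => [|y P IH] g; first by case: g => [|? []].
have cons_IH g' : rcons (tau P) La = g' ++ next_letter x :: La :: s ->
    exists G S, y :: P = G ++ x :: S /\ La :: s = rcons (tau S) La.
  by move=> /IH[G [S [-> ->]]]; exists (y :: G), S.
have here : y = x -> La :: s = rcons (tau P) La ->
    exists G S, y :: P = G ++ x :: S /\ La :: s = rcons (tau S) La.
  by move=> -> ->; exists [::], P.
rewrite tau_cons rcons_cat; case: g => [|z g].
  by case: y here {cons_IH IH} => here; case: x here => here //= [] // e; apply: here.
case: y here cons_IH => here cons_IH /= [_].
- case: g => [|z' g] [] e; last by apply: cons_IH.
  by case: x here e {IH cons_IH} => here // _ e; apply: here.
- case: g => [|z' g] [] e; last by apply: cons_IH.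
  by case: x here e {IH cons_IH} => here // _ e; apply: here.
- exact: cons_IH.
Qed.

(** Blocks are decoded from the left: each is identified by the letter after its first a, and the a
    closing [tau v] settles the last one. *)
Lemma desubstitute_prefix v S h :
  rcons (tau S) La = rcons (tau v) La ++ h ->
  exists2 S', S = v ++ S' & rcons (tau S') La = La :: h.
Proof.
elim: v S => [|y v IH] S; first by exists S.
have [s es] := tau_rcons_La v.
case: S => [|z S].
  by rewrite tau_cons rcons_cat es; case: y.
have [s' es'] := tau_rcons_La S.
rewrite !tau_cons !rcons_cat => e.
suff eyz : y = z.
  move: e; rewrite eyz -catA => /eqP; rewrite eqseq_cat // eqxx => /eqP /IH.
  by case=> S' -> eS'; exists S'.
by move: e; rewrite es es'; case: y; case: z.
Qed.

Lemma infix_desubstitute (x : letter) v P :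
  infix (next_letter x :: rcons (rcons (tau v) La) (next_letter x))
        (rcons (tau P) La) ->
  infix (x :: rcons v x) P.
Proof.
move=> /infixP[g [h]]; rewrite /= cat_rcons => e.
have [s es] := tau_rcons_La v; move: e; rewrite es => /desubstitute_cons.
rewrite -cat_cons -es => -[G [S [-> /esym /desubstitute_prefix[S' ->]]]].
(* An empty [S'] leaves a single a, with no room for the final letter, which also identifies [z]. *)
case: S' => [|z S'] // ez; suff -> : z = x.
  by apply/infixP; exists G, S'; rewrite /= cat_rcons.
have [s' es'] := tau_rcons_La S'.
by move: ez; rewrite tau_cons rcons_cat es'; case: z; case: x.
Qed.

(** Desubstitution descends to j = 0, where aa does not occur in abacaba. *)
Lemma kernel_notin_central j :
  ~~ infix (central_letter j :: rcons (central j) (central_letter j))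
           (central j.+3).
Proof. by elim: j => // j; apply: contra => /infix_desubstitute. Qed.

(** Reversing the prefix P_j x_j of P_(j+3) gives this suffix; the letter following P_(j+3) is again
    x_j and completes the kernel word. *)
Lemma kernel_suffix_central j :
  exists u, central j.+3 = u ++ central_letter j :: central j.
Proof.
have /prefixP[u eu] : prefix (rcons (central j) (central_letter j)) (central j.+3).
  by apply: prefix_trans (prefix_centralS j) (prefix_central _); lia.
exists (rev u).
by rewrite -rev_central eu rev_cat rev_rcons rev_central.
Qed.

(** * Palindromic suffixes of prefixes of a palindrome *)

Definition pal_suffixes (w : seq letter) : nat :=
  count (fun i => rev (drop i w) == drop i w) (iota 0 (size w)).

Lemma pal_suffixes_cat u v :
  pal_suffixes (u ++ v) =
  count (fun i => rev (drop i (u ++ v)) == drop i (u ++ v)) (iota 0 (size u))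
  + pal_suffixes v.
Proof.
rewrite /pal_suffixes size_cat iotaD count_cat add0n.
rewrite -[X in iota X (size v)]addn0 iotaDl count_map.
by congr (_ + _); apply: eq_count => i /=; rewrite drop_cat ltnNge leq_addr addKn.
Qed.

(** The occurrence and its mirror image in [Q] both end beyond [P], so [|g| + |K|] and [|h| + |K|]
    are at least [|P| + 1]; their sum is [2|P| + 2], which forces equality. *)
Lemma centered_occurrence (P Q K g h : seq letter) :
  rev Q = Q -> rev K = K -> prefix P Q -> ~~ infix K P ->
  size Q + size K = 2 * size P + 2 ->
  Q = g ++ K ++ h -> size g = size h.
Proof.
move=> rQ rK pPQ nK szQ eQ.
have late g' h' : Q = g' ++ K ++ h' -> size P < size g' + size K.
  move=> e; rewrite ltnNge; apply: contra nK => le.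
  move: pPQ; rewrite prefixE e catA => /eqP <-.
  rewrite take_cat ltnNge size_cat le -catA.
  by apply/infixP; eexists; eexists.
have := late g h eQ; have : size P < size h + size K.
  rewrite -(size_rev h); apply: (late _ (rev g)).
  by rewrite -rQ eQ !rev_cat rK catA.
by have := congr1 size eQ; rewrite !size_cat; lia.
Qed.

Lemma pal_suffixes_closure (P Q K g h : seq letter) i :
  rev P = P -> rev Q = Q -> rev K = K -> prefix P Q -> ~~ infix K P ->
  size Q + size K = 2 * size P + 2 -> Q = g ++ K ++ h ->
  size P < i <= size Q ->
  pal_suffixes (take i Q) = (pal_suffixes (take (i - (size Q - size P)) Q)).+1.
Proof.
move=> rP rQ rK pPQ nK szQ eQ /andP[ltPi leiQ].
have eqgh := centered_occurrence rQ rK pPQ nK szQ eQ.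
have szgh : size g + size g + size K = size Q by rewrite eQ !size_cat; lia.
have K0 : 0 < size K by case: (K) nK; rewrite ?infix0s.
set d := size Q - size P.
have [u eu] : exists u, Q = u ++ P.
  by have /prefixP[v ev] := pPQ; exists (rev v); rewrite -rQ ev rev_cat rP.
have szu : size u = d by rewrite /d eu size_cat; lia.
have leid : i - d <= size P by rewrite /d; lia.
have -> : take (i - d) Q = take (i - d) P.
  by have /prefixP[v ->] := pPQ; rewrite takel_cat.
have eiQ : take i Q = u ++ take (i - d) P.
  by rewrite eu take_cat szu ifF // /d; lia.
rewrite [in LHS]eiQ pal_suffixes_cat -eiQ szu -add1n; congr (_ + _).
(* The only start below [d] is [size Q - i], for which the suffix is centred in [Q]. *)
rewrite -[RHS](_ : count_mem (size Q - i) (iota 0 d) = 1); last first.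
  by rewrite count_uniq_mem ?iota_uniq // mem_iota /d; lia.
apply: eq_in_count => k; rewrite mem_iota /= add0n => ltkd.
have center g1 h1 : drop k (take i Q) = g1 ++ K ++ h1 ->
    k + size g1 = size h1 + (size Q - i).
  move=> e.
  have := @centered_occurrence P Q K (take k Q ++ g1) (h1 ++ drop i Q) rQ rK pPQ nK szQ.
  rewrite !size_cat size_drop size_takel; last lia.
  apply; rewrite -[in LHS](cat_take_drop i Q) -[in LHS](cat_take_drop k (take i Q)).
  by rewrite e take_takel -?catA //; lia.
apply/eqP/eqP => [pal|ek].
  (* The suffix covers the middle [K], since [d = |g| + 1] and [|P| + 1 = |g| + |K|]. *)
  have [g1 [h1 e1]] : exists g1 h1, drop k (take i Q) = g1 ++ K ++ h1.
    exists (drop k g), (take (i - (size g + size K)) h).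
    rewrite eQ catA take_cat size_cat ltnNge ifF; last by lia.
    rewrite -catA drop_cat; case: ltnP => // lek.
    by rewrite [drop k g]drop_oversize // (_ : k - size g = 0) ?drop0 //; lia.
  (* Adding the [center] equations of this occurrence and of its mirror image in the suffix gives
     [k = size Q - i]. *)
  have := center _ _ e1; have := center (rev h1) (rev g1).
  rewrite !size_rev -[in X in X -> _]pal e1 !rev_cat rK catA => /(_ erefl); lia.
rewrite rev_drop rev_take rQ take_drop size_takel // -ek subnK //; lia.
Qed.

(** * The recurrence on central words *)

(** The constant -1 cancels in differences of consecutive kernel numbers, leaving the Tribonacci
    recurrence. *)
Lemma knum_tnum j : knum_nat j.+4 = knum_nat j.+3 + tnum_shift j.+1.
Proof.
suff: [/\ knum_nat j.+4 = knum_nat j.+3 + tnum_shift j.+1,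
  knum_nat j.+1.+4 = knum_nat j.+1.+3 + tnum_shift j.+2,
  knum_nat j.+2.+4 = knum_nat j.+2.+3 + tnum_shift j.+3 & 0 < knum_nat j.+3].
  by case.
elim: j => // j [h0 h1 h2 h3]; split=> //; last by lia.
have -> : tnum_shift j.+4 = tnum_shift j.+3 + tnum_shift j.+2 + tnum_shift j.+1 by [].
by have := knum_natS j.+3; rewrite (knum_natS j.+4); lia.
Qed.

Lemma pal_suffixes_window j i :
  knum_nat j.+3.+4 <= i.+1 < knum_nat j.+4.+4 ->
  pal_suffixes (take i (central j.+4)) =
  (pal_suffixes (take (i - tnum_shift j.+4.+1) (central j.+4))).+1.
Proof.
have eP := size_central j.+3; have eQ := size_central j.+4.
have eK := size_central j.
have eD := knum_tnum j.+4.
have -> : tnum_shift j.+4.+1 = size (central j.+4) - size (central j.+3) by lia.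
have [u eu] := kernel_suffix_central j.
have /prefixP[v ev] := prefix_centralS j.+3.
move=> hi; apply: (@pal_suffixes_closure _ _
  (central_letter j :: rcons (central j) (central_letter j)) u v).
- exact: rev_central.
- exact: rev_central.
- by rewrite rev_cons rev_rcons rev_central rcons_cons.
- by apply: prefix_central.
- exact: kernel_notin_central.
(* This is k_(j+8) + k_(j+4) = 2 k_(j+7), the difference of two instances of the kernel
   recurrence. *)
- rewrite [size (_ :: _)]/= size_rcons.
  have := knum_natS j.+4.+1; have := knum_natS j.+4; have := knum_nat_leS j.+4.
  by lia.
- by rewrite ev eu central_letter3 -cats1 -!catA /= cat_rcons.
- by lia.
Qed.

(** * From central words to T and b *)

Lemma iter_tau_prefix_central j : prefix (iter j tau [:: La]) (central j.+1).
Proof.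
elim: j => // j IH; rewrite iterS centralS.
exact: prefix_trans (tau_prefix IH) (prefix_rcons _ _).
Qed.

Lemma subword_central j n :
  n <= size (central j) -> subword tribonacci 1 n = take n (central j).
Proof.
move=> le; apply: (@eq_from_nth _ La).
  by rewrite size_subword size_takel.
rewrite size_subword => i lt; rewrite (nth_map 0) ?size_iota // nth_iota // add1n.
have si := size_iter_tau i.+1.
rewrite /tribonacci [i.+1.-1]/= nth_take //.
rewrite -(nth_prefix _ (iter_tau_prefix_central _) (ltnW si)).
have lij : i < size (central j) := leq_trans lt le.
have lii : i < size (central i.+2).
  exact: leq_trans (ltnW si) (size_prefix (iter_tau_prefix_central i.+1)).
case: (leqP j i.+2) => lej.
  by rewrite (nth_prefix _ (prefix_central lej) lij).
by rewrite (nth_prefix _ (prefix_central (ltnW lej)) lii).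
Qed.

Lemma drop_subword T k n : drop k (subword T 1 n) = subword T k.+1 (n - k).
Proof. by rewrite /subword -map_drop drop_iota add1n. Qed.

(** With the end fixed, the length of a palindrome gives its start, and the start gives its rank
    p. *)
Lemma bnumE n : bnum n = pal_suffixes (subword tribonacci 1 n).
Proof.
pose f k := (subword tribonacci k.+1 (n - k),
             count (occurs_at (subword tribonacci k.+1 (n - k))) (iota 1 k.+1)).
pose s := [seq k <- iota 0 n |
           rev (subword tribonacci k.+1 (n - k)) == subword tribonacci k.+1 (n - k)].
have occ k : occurs_at (subword tribonacci k.+1 (n - k)) k.+1.
  by rewrite /occurs_at size_subword eqxx.
have cnt k : 0 < count (occurs_at (subword tribonacci k.+1 (n - k))) (iota 1 k.+1).
  by rewrite -has_count; apply/hasP; exists k.+1; rewrite ?occ // mem_iota; lia.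
have -> : bnum n = #|` [fset x in map f s]%fset|.
  rewrite /bnum; congr (#|` _|); apply/fsetP => -[w p].
  rewrite (in_fset_set (finite_pal_occ n)) !inE /=; apply/idP/idP.
    rewrite inE => -[[nw rw _] _ [[|k] [/= /andP[// _ /eqP ew] <-] sw]].
    have szw : size w = n - k by move: sw => /=; lia.
    have w0 : 0 < size w by case: (w) nw.
    apply/mapP; exists k; last by rewrite /f -szw ew.
    by rewrite mem_filter mem_iota -szw ew rw eqxx; lia.
  move=> /mapP[k]; rewrite mem_filter mem_iota => /andP[/eqP rk ltk] [-> ->].
  rewrite inE; split.
  - split; [|exact: rk|by exists k.+1; apply: occ].
    by move=> /(congr1 size); rewrite size_subword /=; lia.
  - exact: cnt.
  - by exists k.+1; rewrite ?[size _]size_subword; [split; first exact: occ|lia].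
rewrite card_fseq undup_id; last first.
  rewrite map_inj_in_uniq ?filter_uniq ?iota_uniq // => k l.
  rewrite !mem_filter !mem_iota => hk hl [/(congr1 size)].
  by rewrite !size_subword; lia.
rewrite size_map size_filter /pal_suffixes size_subword.
by apply: eq_count => k; rewrite drop_subword.
Qed.

(** Covers the windows m = 1, 2, 3, too early for the kernel word argument, and the initial values
    of D. *)
Lemma bnum_small k : k < 8 -> bnum k = nth 0 [:: 0; 1; 1; 2; 1; 2; 2; 3] k.
Proof.
have <- : map pal_suffixes (mkseq (subword tribonacci 1) 8)
          = [:: 0; 1; 1; 2; 1; 2; 2; 3] by vm_compute.
by move=> ltk8; rewrite (nth_map [::]) ?size_mkseq // nth_mkseq // bnumE.
Qed.

Lemma bnum_window m i : 0 < m -> knum_nat m.+3 <= i.+1 < knum_nat m.+4 ->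
  bnum i = (bnum (i - tnum_shift m.+1)).+1.
Proof.
case: m => // m _; case: (leqP 3 m) => [le3|lt4] hi.
  case: m le3 hi => [|[|[|j]]] // _ hi; have sz := size_central j.+4.
  have le : i <= size (central j.+4) by lia.
  have le' : i - tnum_shift j.+4.+1 <= size (central j.+4) by lia.
  rewrite !bnumE (subword_central le) (subword_central le').
  exact: pal_suffixes_window.
have [k4 k5 k6 k7] : [/\ knum_nat 4 = 2, knum_nat 5 = 3, knum_nat 6 = 5
  & knum_nat 7 = 9] by [].
have lti8 : i < 8 by case: m lt4 hi => [|[|[|]]] // _; rewrite ?k4 ?k5 ?k6 ?k7; lia.
rewrite !bnum_small; [|lia|lia].
case: m lt4 hi => [|[|[|]]] // _; rewrite ?k4 ?k5 ?k6 ?k7;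
  by case: i lti8 => [|[|[|[|[|[|[|[|]]]]]]]].
Qed.

(** * Sums over windows and the closed form D *)

Lemma sum_bnum_shift m u v : 0 < m ->
  knum_nat m.+3 - 1 <= u -> u <= v -> v <= knum_nat m.+4 - 1 ->
  \sum_(u <= i < v) bnum i =
  \sum_(u - tnum_shift m.+1 <= i < v - tnum_shift m.+1) bnum i + (v - u).
Proof.
move=> m0 leu leuv lev.
have k0 : 0 < knum_nat m by apply: (@leq_trans (knum_nat 1)); rewrite ?knum_nat_le.
have ek : knum_nat m.+3 = knum_nat m + tnum_shift m.+1.
  have := knum_tnum m; have := knum_natS m.+1; have := knum_natS m.
  by have := knum_nat_leS m; lia.
rewrite -{1}(@subnK (tnum_shift m.+1) u); last by lia.
rewrite big_addn (@eq_big_nat _ _ _ _ _ _ (fun i => bnum i + 1)).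
  by rewrite big_split sum_nat_const_nat muln1; congr (_ + _); lia.
by move=> i hi; rewrite (@bnum_window m) ?addnK ?addn1 //; lia.
Qed.

Lemma sum_nat_split (F : nat -> nat) a b c : a <= b -> b <= c ->
  \sum_(a <= i < c) F i = \sum_(a <= i < b) F i + \sum_(b <= i < c) F i.
Proof. exact: big_cat_nat. Qed.

Definition window_sum (m : nat) : nat :=
  \sum_(knum_nat m.+3 - 1 <= i < knum_nat m.+4 - 1) bnum i.

(** Shifted back by t_(m+2), window m+3 becomes the union of windows m, m+1, m+2; t_(m+2) is also
    its length, hence the number of added ones. *)
Lemma window_sumS m : window_sum m.+3 =
  window_sum m + window_sum m.+1 + window_sum m.+2 + tnum_shift m.+4.
Proof.
have := knum_nat_leS m.+3; have := knum_nat_leS m.+4.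
have := knum_nat_leS m.+1.+4; have := knum_nat_leS m.+2.+4 => l6 l5 l4 l3.
have k0 : 0 < knum_nat m.+3 by apply: (@leq_trans (knum_nat 3)); rewrite ?knum_nat_le.
have e6 := knum_tnum m.+3.
have e3 : knum_nat m.+3.+3 = knum_nat m.+3 + tnum_shift m.+4.
  by have := knum_natS m.+4; have := knum_natS m.+3; lia.
rewrite /window_sum (@sum_bnum_shift m.+3) //; last by lia.
rewrite (_ : knum_nat m.+3.+3 - 1 - _ = knum_nat m.+3 - 1); last by lia.
rewrite (_ : knum_nat m.+3.+4 - 1 - _ = knum_nat m.+3.+3 - 1); last by lia.
rewrite (@sum_nat_split _ _ (knum_nat m.+4 - 1)); [|lia|lia].
rewrite (@sum_nat_split _ (knum_nat m.+4 - 1) (knum_nat m.+1.+4 - 1)); [|lia|lia].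
by move: (tnum_shift _) e6 e3 => t e6 e3; rewrite !addnA; congr (_ + _); lia.
Qed.

Lemma tnumE (j : int) i : (j + 2)%R = Posz i -> tnum j = tnum_shift i.
Proof. by rewrite /tnum => ->. Qed.

Lemma DnumE (k : nat) (a := (tnum_shift k.+2)%:R%R : rat)
    (b := (tnum_shift k.+1)%:R%R : rat) (c := (tnum_shift k)%:R%R : rat) :
  Dnum (Posz k) = (k%:R / 22 * (3 * a + 7 * b + 2 * c)
                   + 1 / 22 * (3 * a - 3 * b + 4 * c))%R.
Proof.
rewrite /Dnum (@tnumE (Posz k) k.+2) ?(@tnumE (Posz k - 1) k.+1); try lia.
by rewrite (@tnumE (Posz k - 2) k); last lia.
Qed.

(** Both sides satisfy [window_sumS] and agree at 0, 1, 2. The forcing term is itself Tribonacci,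
    whence the factor j in D. *)
Lemma Dnum_window m : Dnum (Posz m) = (window_sum m)%:R%R.
Proof.
suff: [/\ Dnum (Posz m) = (window_sum m)%:R%R,
  Dnum (Posz m.+1) = (window_sum m.+1)%:R%R &
  Dnum (Posz m.+2) = (window_sum m.+2)%:R%R] by case.
elim: m => [|m [h0 h1 h2]].
  have [k3 k4 k5 k6] : [/\ knum_nat 3 = 1, knum_nat 4 = 2, knum_nat 5 = 3
    & knum_nat 6 = 5] by [].
  have -> : window_sum 0 = 0 by rewrite /window_sum k3 k4 big_nat1 bnum_small.
  have -> : window_sum 1 = 1 by rewrite /window_sum k4 k5 big_nat1 bnum_small.
  have -> : window_sum 2 = 3.
    by rewrite /window_sum k5 k6 big_ltn // big_nat1 !bnum_small.
  by split; apply/eqP; vm_compute.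
split=> //; rewrite window_sumS !natrD -h0 -h1 -h2 !DnumE.
have -> : tnum_shift m.+4.+1 = tnum_shift m.+4 + tnum_shift m.+3 + tnum_shift m.+2 by [].
have -> : tnum_shift m.+4 = tnum_shift m.+3 + tnum_shift m.+2 + tnum_shift m.+1 by [].
have -> : tnum_shift m.+3 = tnum_shift m.+2 + tnum_shift m.+1 + tnum_shift m by [].
rewrite !natrD.
have -> : (m.+3%:R = m%:R + 3 :> rat)%R by rewrite -addn3 natrD.
have -> : (m.+2%:R = m%:R + 2 :> rat)%R by rewrite -addn2 natrD.
have -> : (m.+1%:R = m%:R + 1 :> rat)%R by rewrite -addn1 natrD.
by field.
Qed.

(** * The three cases *)

Local Open Scope ring_scope.

Theorem corollary7p5 (n : nat) (hn : (15 <= n)%N) (m : int)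
    (hm : (knum (m + 3) <= n + 1 < knum (m + 4))%N) :
  let alpha : nat := (knum (m + 3) + tnum (m - 4))%N in
  let beta : nat := (knum (m + 3) + tnum (m - 4) + tnum (m - 3))%N in
  let B (u v : nat) : rat := \sum_(u <= i < v.+1) (bnum i)%:R in
  4 <= m /\
  B (knum (m + 3) - 1)%N n =
    if (n + 1 < alpha)%N then
      B (knum m - 1)%N (n - tnum (m - 1))%N
      + n%:R - (knum (m + 3))%:R + 2
    else if (n + 1 < beta)%N then
      B (knum (m + 1) - 1)%N (n - tnum (m - 1))%N
      + Dnum (m - 3) + n%:R - (knum (m + 3))%:R + 2
    else
      B (knum (m + 2) - 1)%N (n - tnum (m - 1))%N
      + Dnum (m - 3) + Dnum (m - 2) + n%:R - (knum (m + 3))%:R + 2.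
Proof.
move=> alpha beta B.
have [M eM] : exists M : nat, m = Posz M.+4.
  case e : (m + 4) hm => [i|//]; last by rewrite andbC.
  move=> /andP[_ /= hi]; exists (i - 8)%N.
  (* As n + 1 is at least 16 = k_8, the bound n + 1 < k_(m+4) forces m + 4 > 8. *)
  have k8 : knum_nat 8 = 16 by [].
  suff : (8 < i)%N by lia.
  by rewrite ltnNge; apply/negP => /knum_nat_le; rewrite k8; lia.
have eBS u v : B u v = (\sum_(u <= i < v.+1) bnum i)%N%:R by rewrite natr_sum.
have D1 : Dnum (m - 3) = (window_sum M.+1)%:R by rewrite -Dnum_window; congr Dnum; lia.
have D2 : Dnum (m - 2) = (window_sum M.+2)%:R by rewrite -Dnum_window; congr Dnum; lia.
have K3 : knum (m + 3) = knum_nat M.+4.+3 by rewrite eM -PoszD addn3.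
have K4 : knum (m + 4) = knum_nat M.+4.+4 by rewrite eM -PoszD addn4.
have K2 : knum (m + 2) = knum_nat M.+4.+2 by rewrite eM -PoszD addn2.
have K1 : knum (m + 1) = knum_nat M.+4.+1 by rewrite eM -PoszD addn1.
have K0 : knum m = knum_nat M.+4 by rewrite eM.
have T1 : tnum (m - 1) = tnum_shift M.+4.+1 by apply: tnumE; lia.
have T3 : tnum (m - 3) = tnum_shift M.+3 by apply: tnumE; lia.
have T4 : tnum (m - 4) = tnum_shift M.+2 by apply: tnumE; lia.
split; first by rewrite eM.
move: hm; rewrite !eBS /alpha /beta D1 D2 K4 K3 K2 K1 K0 T1 T3 T4 => /andP[le lt].
have e7 := knum_tnum M.+4; have e5 := knum_tnum M.+2; have e4 := knum_tnum M.+1.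
have k0 : (0 < knum_nat M.+4)%N by apply: (@leq_trans (knum_nat 4)); rewrite ?knum_nat_le.
have e3 : (knum_nat M.+4.+3 = knum_nat M.+4 + tnum_shift M.+4.+1)%N.
  by have := knum_natS M.+4.+1; have := knum_natS M.+4; have := knum_nat_leS M.+4; lia.
rewrite (@sum_bnum_shift M.+4); [|lia|lia|lia|lia].
rewrite (_ : (knum_nat M.+4.+3 - 1 - _ = knum_nat M.+4 - 1)%N); last by lia.
rewrite (_ : ((n - _).+1 = n.+1 - tnum_shift M.+4.+1)%N); last by lia.
have e : ((n.+1 - (knum_nat M.+4.+3 - 1))%:R = n%:R - (knum_nat M.+4.+3)%:R + 2 :> rat).
  have -> : (n.+1 - (knum_nat M.+4.+3 - 1) = n + 2 - knum_nat M.+4.+3)%N by lia.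
  by rewrite natrB ?natrD; [ring|lia].
rewrite natrD e !addrA.
(* Since k_(m+1) = k_m + t_(m-4) and k_(m+2) = k_(m+1) + t_(m-3), passing [alpha], then [beta],
   means that the shifted range contains window m-3, then also window m-2. *)
case: ltnP => // hal.
rewrite (@sum_nat_split _ _ (knum_nat M.+4.+1 - 1)); [|lia|lia].
rewrite -/(window_sum M.+1) natrD.
case: ltnP => hbe; first by rewrite [_ + (window_sum _)%:R]addrC.
rewrite (@sum_nat_split _ _ (knum_nat M.+4.+2 - 1)); [|lia|lia].
by rewrite -/(window_sum M.+2) natrD; ring.
Qed.
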